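(* Let $\mathbb{F}=\mathbb{R}$ or $\mathbb{C}$, let $2\le n\le m$ be integers, and let $A\in\mathbb{F}^{m\times n}$ be a matrix of full column rank $n$. Then the normal form $\{A\hat{s}_1,\ldots,A\hat{s}_n\}$ of $A$ exists and is unique; that is, the sets $\mathcal{S}$ and $\mathcal{S}_2,\ldots,\mathcal{S}_n$ occurring in its recursive definition (see context) are non-empty and each of the $n$ maximisation problems defining $\hat{s}_1,\ldots,\hat{s}_n$ has exactly one solution. In this sense, every vector space $V\subseteq\mathbb{F}^m$ of dimension $n\ge 2$ has a unique basis in normal form: if $A$ and $A'$ are two $m\times n$-matrices whose columns are bases of the same $V$, their normal forms coincide. If $n=m$, i.e. if $A$ is a square matrix, the normal form of $A$ is given by the $m\times m$ unit matrix: $(A\hat{s}_1,\ldots,A\hat{s}_m)=\mathbb{1}_m$.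
   Context: Let $r_1,\ldots,r_m\in\mathbb{F}^n$ be the rows of $A$, and $R=\{r_1,\ldots,r_m\}$ the set of rows. The columns of $A$ form a basis of the $n$-dimensional vector space $V\subseteq\mathbb{F}^m$. Selections and normal vectors. A selection is a subset $S\subseteq R$ of rows with $\dim\operatorname{span}(S)=n-1$. A normal vector of a selection $S$ is a vector $s\in\mathbb{F}^n$, $s\ne0$, with $r\cdot s=\sum_{i=1}^n r_i s_i=0$ for all $r\in S$ (here $r_i, s_i$ denote components of $r$ and $s$; no complex conjugation is used, also when $\mathbb{F}=\mathbb{C}$). Since $\dim\operatorname{span}(S)=n-1$, it is determined up to a non-zero scalar, and since $A$ has full column rank, $As\neq0$. The normalised normal vector $\hat{s}$ of $S$ is the unique normal vector of $S$ such that the first non-vanishing entry of $A\hat{s}\in\mathbb{F}^m$ is $+1$. Let $\mathcal{S}$ be the set of all different normalised normal vectors $\hat{s}$ obtained from all selections $S\subseteq R$. Ordering. For $\hat{s}\in\mathcal{S}$ and $j\in\{1,\ldots,m\}$ put $\theta_j=1$ if $(A\hat{s})_j=0$ and $\theta_j=0$ otherwise, and define $$\theta^{(1)}(\hat{s})=2^{\,m+\sum_{j=1}^m\theta_j},\qquad \theta^{(2)}(\hat{s})=\sum_{j=1}^m\theta_j2^{j-1},\qquad \theta(\hat{s})=\theta^{(1)}(\hat{s})+\theta^{(2)}(\hat{s}).$$ Normal form. Define recursively $$\hat{s}_1=\operatorname*{argmax}_{\hat{s}\in\mathcal{S}}\theta(\hat{s}),\qquad \hat{s}_j=\operatorname*{argmax}_{\hat{s}\in\mathcal{S}_j}\theta(\hat{s})\quad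 (j=2,\ldots,n),$$ where $\mathcal{S}_j=\{\hat{s}\in\mathcal{S} : \hat{s}\text{ is linearly independent of }\hat{s}_1,\ldots,\hat{s}_{j-1}\}$, i.e. $\hat{s}\notin\operatorname{span}(\hat{s}_1,\ldots,\hat{s}_{j-1})$. The normal form of $A$ (of the basis given by the columns of $A$) is the set of column vectors $\{A\hat{s}_1,\ldots,A\hat{s}_n\}$, listed in this order when written as a matrix. *)

(* Defs.v *)
From HB Require Import structures.
From mathcomp Require Import all_boot all_order all_algebra finmap.
From mathcomp Require Import boolp classical_sets reals.
From mathcomp.real_closed Require Import complex.

Set Implicit Arguments.
Unset Strict Implicit.
Unset Printing Implicit Defensive.

Import GRing.Theory.

Local Open Scope classical_set_scope.
Local Open Scope ring_scope.

Section NormalForm.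
Variables (F : fieldType) (m n : nat).
Implicit Types (A B : 'M[F]_(m, n)) (s : 'cV[F]_n) (t : seq 'cV[F]_n).

Definition columns A : n.-tuple 'cV[F]_m := [tuple col j A | j < n].

(* As in the mathematical definition, this is a set of vectors: equal rows of A
   are identified. *)
Definition rows A : {fset 'rV[F]_n} := [fset row i A | i in 'I_m]%fset.

Definition selection A (S : {fset 'rV[F]_n}) : Prop :=
  (S `<=` rows A)%fset /\ \dim <<enum_fset S>>%VS = n.-1.

(* The pairing is bilinear: no conjugation, also over the complex numbers. *)
Definition normal_vector (S : {fset 'rV[F]_n}) s : Prop :=
  s != 0 /\ forall r, r \in S -> \sum_(i < n) r 0 i * s i 0 = 0.

Definition normalised A s : Prop :=
  exists i : 'I_m,
    (A *m s) i 0 = 1 /\ forall k : 'I_m, (k < i)%N -> (A *m s) k 0 = 0.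

Definition normalised_normals A : set 'cV[F]_n :=
  [set s | exists S, [/\ selection A S, normal_vector S s & normalised A s]].

Definition theta_ind A s (j : 'I_m) : nat := ((A *m s) j 0 == 0).

Definition theta1 A s : nat := (2 ^ (m + \sum_(j < m) theta_ind A s j))%N.

(* j : 'I_m counts from 0, whence the exponent j instead of j - 1. *)
Definition theta2 A s : nat := (\sum_(j < m) theta_ind A s j * 2 ^ j)%N.

Definition theta A s : nat := (theta1 A s + theta2 A s)%N.

Definition argmax (T : Type) (f : T -> nat) (X : set T) : set T :=
  [set x | X x /\ forall y, X y -> (f y <= f x)%N].

(* The feasible set S_j of the j-th step, where t lists the j - 1 vectors chosen
   before. For t = [::] it is the whole of normalised_normals A, see
   candidates_nil. *)
Definition candidates A t : set 'cV[F]_n :=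
  [set s | normalised_normals A s /\ s \notin <<t>>%VS].

Lemma candidates_nil A : candidates A [::] = normalised_normals A.
Proof.
apply/seteqP; split => [s []//|s sA]; split => //.
by rewrite span_nil memv0; case: sA => S [_ []].
Qed.

(* t lists the outcomes of the first (size t) steps of the recursion. *)
Definition recursion A t : Prop :=
  forall j, (j < size t)%N ->
    argmax (theta A) (candidates A (take j t)) (nth 0 t j).

(* B is a normal form of A, written as a matrix. *)
Definition normal_form A B : Prop :=
  exists2 t : n.-tuple 'cV[F]_n,
    recursion A t & forall j : 'I_n, col j B = A *m tnth t j.

End NormalForm.

(* Main.v *)
(* The zero set of A s contains the selection defining s, whose rows have rank
   n - 1, so it determines s up to a scalar, and normalisation fixes the scalar.
   As 2 ^ m divides theta1 and theta2 < 2 ^ m, theta determines theta2 by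
   reduction modulo 2 ^ m, and theta2 is the binary encoding of the zero set.
   Thus theta is injective on the normalised normal vectors, whence the uniqueness of all
   maximisers. Existence holds because n independent rows of A form an
   invertible matrix, the columns of whose inverse are, up to scaling, normal
   vectors spanning the whole space.

   A normalised s is a normal vector of a selection iff A s has minimal support
   in V, so passing from A to A P for an invertible P just replaces s by P^-1 s.
   In particular a square A reduces to the identity matrix, for which the
   normalised normal vectors are the unit vectors and theta decreases along the
   standard ordering. *)

Require Import Defs.
From mathcomp Require Import all_boot all_order all_algebra finmap zify.
From mathcomp Require Import boolp classical_sets reals.
From mathcomp.real_closed Require Import complex.

Set Implicit Arguments.
Unset Strict Implicit.
Unset Printing Implicit Defensive.

Import GRing.Theory.

Local Open Scope classical_set_scope.
Local Open Scope ring_scope.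

(** * Linear algebra: annihilators of sets of rows *)

(** The map [g] is kept general to serve both row vectors, with [idfun], and column vectors, with
    [trmx]. *)
Lemma free_row_free (F : fieldType) (vT : vectType F) (k n : nat)
    (g : {linear vT -> 'rV[F]_n}) (X : k.-tuple vT) :
  injective g -> free X = row_free (\matrix_(i < k) g X`_i).
Proof.
move=> g_inj.
have comb (c : 'I_k -> F) : (\row_i c i) *m (\matrix_(i < k) g X`_i) =
    g (\sum_(i < k) c i *: X`_i).
  rewrite mulmx_sum_row linear_sum; apply: eq_bigr => i _.
  by rewrite rowK mxE linearZ.
apply/freeP/idP => [Xfree | Mfree c c0 i].
  apply: inj_row_free => v v0; apply/rowP => i; rewrite mxE.
  apply: (Xfree (v 0)); apply: g_inj; rewrite linear0 -comb -v0; congr (_ *m _).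
  by apply/rowP => j; rewrite mxE.
have := row_free_inj Mfree (x1 := \row_i c i) (x2 := 0).
by rewrite comb c0 linear0 mul0mx => /(_ erefl)/rowP/(_ i); rewrite !mxE.
Qed.

(** The rows of [M] are a basis of the span, so the dimension condition of a selection becomes a
    condition on the number of rows, ready for rank-nullity. *)
Lemma span_annihilator (F : fieldType) (n : nat) (X : seq 'rV[F]_n) :
  exists2 M : 'M[F]_(\dim <<X>>, n), row_free M
    & forall s : 'cV[F]_n, M *m s = 0 <-> forall r, r \in X -> r *m s = 0.
Proof.
have bX := vbasisP <<X>>%VS.
exists (\matrix_i (vbasis <<X>>)`_i).
  by rewrite -(@free_row_free F _ _ _ idfun) // (basis_free bX).
move=> s.
have ker (r : 'rV[F]_n) : (r \in lker (linfun (mulmxr s))) = (r *m s == 0).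
  by rewrite memv_ker lfunE.
split=> [Ms r /memv_span rX | Xs].
  have: (<<vbasis <<X>>>> <= lker (linfun (mulmxr s)))%VS.
    apply/span_subvP => u /tnthP[i ->]; rewrite ker.
    have /(congr1 (row i)) := Ms; rewrite row_mul rowK row0 => <-.
    by rewrite (tnth_nth 0).
  by rewrite (span_basis bX) => /subvP/(_ _ rX); rewrite ker => /eqP.
apply/row_matrixP => i; rewrite row_mul rowK row0; apply/eqP; rewrite -ker.
have: (<<X>> <= lker (linfun (mulmxr s)))%VS.
  by apply/span_subvP => u /Xs us; rewrite ker us.
move/subvP; apply; apply: vbasis_mem.
by apply/memt_nth.
Qed.

(** Rank-nullity: the kernel has dimension n - k and contains the line of [s], so it equals that
    line iff n - k = 1. *)
Lemma ker_lineP (F : fieldType) (k n : nat) (M : 'M[F]_(k, n)) (s : 'cV[F]_n) :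
  row_free M -> s != 0 -> M *m s = 0 ->
  k = n.-1 <-> forall s', M *m s' = 0 -> exists c, s' = c *: s.
Proof.
move=> /eqP Mk s0 Ms.
have kerE (s' : 'cV[F]_n) : (M *m s' == 0) = (s'^T <= kermx M^T)%MS.
  rewrite -[s' in LHS]trmxK -[M in LHS]trmxK -trmx_mul trmx_eq0.
  exact/eqP/sub_kermxP.
have rs : \rank s^T = 1%N by rewrite rank_rV trmx_eq0 s0.
have sker : (s^T <= kermx M^T)%MS by rewrite -kerE Ms.
have rker : \rank (kermx M^T) = (n - k)%N by rewrite mxrank_ker mxrank_tr Mk.
have := mxrank_leqif_sup sker; rewrite rs rker => -[le1 eq1].
(* [le1] excludes n = 0, where [n.-1] would be truncated. *)
have -> : (k = n.-1) <-> (kermx M^T <= s^T)%MS by rewrite -eq1; lia.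
split=> [ks s' /eqP|lin].
  rewrite kerE => /submx_trans/(_ ks)/sub_rVP[c sc]; exists c.
  by apply: trmx_inj; rewrite sc linearZ.
apply/row_subP => i; apply/sub_rVP.
have [|c uc] := lin (row i (kermx M^T))^T.
  by apply/eqP; rewrite kerE trmxK row_sub.
by exists c; rewrite -[LHS]trmxK uc linearZ.
Qed.

(* The support of A s is minimal among the supports of the non-zero vectors of
   the column space. This describes the normal vectors of selections through
   the vectors A s only, hence independently of the chosen basis. *)
Definition minimal_support (F : fieldType) (m n : nat) (A : 'M[F]_(m, n))
    (s : 'cV[F]_n) : Prop :=
  forall s' : 'cV[F]_n,
    (forall i, (A *m s) i 0 = 0 -> (A *m s') i 0 = 0) -> exists c, s' = c *: s.

Lemma normalised_neq0 (F : fieldType) (m n : nat) (A : 'M[F]_(m, n)) s :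
  normalised A s -> s != 0.
Proof.
move=> [i [si _]]; apply/eqP => s0; move: si; rewrite s0 mulmx0 mxE => /eqP.
by rewrite eq_sym oner_eq0.
Qed.

Lemma normalised_normalsE (F : fieldType) (m n : nat) (A : 'M[F]_(m, n)) s :
  normalised_normals A s <-> normalised A s /\ minimal_support A s.
Proof.
have rowE i (u : 'cV[F]_n) : row i A *m u = 0 <-> (A *m u) i 0 = 0.
  rewrite -row_mul; split=> [/rowP/(_ 0)|u0]; first by rewrite !mxE.
  by apply/rowP => k; rewrite ord1 !mxE -[RHS]u0 mxE.
have sumE (r : 'rV[F]_n) (u : 'cV[F]_n) :
    \sum_(i < n) r 0 i * u i 0 = 0 <-> r *m u = 0.
  split=> [u0|/rowP/(_ 0)]; last by rewrite !mxE.
  by apply/rowP => k; rewrite ord1 !mxE.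
split=> [[S [[SA dimS] [s0 Ss] ns]]|[ns mins]].
  split=> // s' Zs'; have [M Mfree Mann] := span_annihilator (enum_fset S).
  have Ms : M *m s = 0 by apply/Mann => r /Ss /sumE.
  apply: (iffLR (ker_lineP Mfree s0 Ms) dimS); apply/Mann => r rS.
  have /imfsetP[i _ ri] := fsubsetP SA _ rS.
  by rewrite ri; apply/rowE/Zs'/rowE; rewrite -ri; apply/sumE/Ss.
(* The largest possible selection for [s]: minimality of the support makes its annihilator a
   line. *)
pose S := [fset r in rows A | r *m s == 0]%fset.
have SP r : r \in S = (r \in rows A) && (r *m s == 0) by rewrite !inE.
have s0 := normalised_neq0 ns.
exists S; split=> //; last first.
  by split=> // r; rewrite SP => /andP[_ /eqP rs]; apply/sumE.
split; first by apply/fsubsetP => r; rewrite SP => /andP[].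
have [M Mfree Mann] := span_annihilator (enum_fset S).
have Ms : M *m s = 0 by apply/Mann => r; rewrite [_ \in _]SP => /andP[_ /eqP].
apply/(ker_lineP Mfree s0 Ms) => s' /Mann Ms'; apply: mins => i Asi.
apply/rowE/Ms'; rewrite [_ \in _]SP; apply/andP; split.
  by apply/imfsetP; exists i.
by apply/eqP/rowE.
Qed.

Lemma normalised_scale (F : fieldType) (m n : nat) (A : 'M[F]_(m, n)) s :
  A *m s != 0 -> exists2 c, c != 0 & normalised A (c *: s).
Proof.
move=> As0.
have /ex_minnP[k] : exists k,
    [exists i : 'I_m, (i == k :> nat) && ((A *m s) i 0 != 0)].
  case/matrix0Pn: As0 => i [j]; rewrite (ord1 j) => ij.
  by exists i; apply/existsP; exists i; rewrite eqxx.
case/existsP=> i /andP[/eqP <-{k} si] mini.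
exists ((A *m s) i 0)^-1; first by rewrite invr_eq0.
exists i; rewrite -scalemxAr; split=> [|k ki]; first by rewrite mxE mulVf.
rewrite mxE; have [->|sk] := eqVneq ((A *m s) k 0) 0; first by rewrite mulr0.
have: (i <= k)%N by apply: mini; apply/existsP; exists k; rewrite eqxx.
by rewrite leqNgt ki.
Qed.

Lemma normalised_scale_inj (F : fieldType) (m n : nat) (A : 'M[F]_(m, n)) s c :
  normalised A s -> normalised A (c *: s) -> c = 1.
Proof.
move=> [i [si mini]] [j []]; rewrite -scalemxAr mxE => cj minj.
case: (ltngtP i j) => [/minj|/mini s0|/val_inj ij].
- by rewrite mxE si mulr1 => c0; move: cj; rewrite c0 mul0r.
- by move: cj; rewrite s0 mulr0 => /eqP; rewrite eq_sym oner_eq0.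
- by rewrite -cj -ij si mulr1.
Qed.

(** * Normalised normal vectors outside a proper subspace *)

Lemma exists_normal_notin (F : fieldType) (m n : nat) (A : 'M[F]_(m, n))
    (U : {vspace 'cV[F]_n}) :
  \rank A = n -> (\dim U < n)%N ->
  exists2 s, normalised_normals A s & s \notin U.
Proof.
move=> rA dU.
have fA : row_full A by apply/eqP.
set f := fullrankfun fA; have := fullrowsub_unit fA; rewrite -/f => uM.
set M := rowsub f A in uM; pose N := invmx M.
have Mf (s : 'cV[F]_n) j : (M *m s) j 0 = (A *m s) (f j) 0.
  by rewrite !mxE; apply: eq_bigr => k _; rewrite mxE.
(* The columns of [N] span the whole space, so they cannot all lie in [U]. *)
have [k kU|allU] := pickP (fun k => col k N \notin U); last first.
  suff fU : (fullv <= U)%VS.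
    by move: (dimvS fU); rewrite dimvf /dim /= muln1 leqNgt dU.
  apply/subvP => v _.
  have -> : v = \sum_(k < n) (M *m v) k 0 *: col k N.
    rewrite -[LHS](mulKmx uM) -/N; set w := M *m v.
    apply/colP => i; rewrite summxE mxE; apply: eq_bigr => k _.
    by rewrite !mxE mulrC.
  by apply: memv_suml => k _; apply: memvZ; have /negbFE := allU k.
have MN j : (A *m col k N) (f j) 0 = (j == k)%:R.
  by rewrite -Mf colE mulmxA mulmxV // mul1mx mxE andbT.
have [|c c0 nc] := @normalised_scale _ _ _ A (col k N).
  apply/eqP => /colP/(_ (f k)); rewrite MN eqxx mxE => /eqP.
  by rewrite oner_eq0.
exists (c *: col k N); last first.
  by apply: contra kU => /(memvZ c^-1); rewrite scalerA mulVf // scale1r.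
apply/normalised_normalsE; split=> // s' Z.
(* By [Z], the vector M s' vanishes off position k; applying N recovers s' as a multiple of the k-th
   column of N. *)
exists ((A *m s') (f k) 0 / c); rewrite scalerA divfK //.
rewrite -[LHS](mulKmx uM) -/N colE scalemxAr; congr (N *m _).
apply/colP => j; rewrite Mf [RHS]mxE [delta_mx _ _ _ _]mxE andbT.
have [->|jk] := eqVneq j k; first by rewrite mulr1.
rewrite mulr0 Z // -scalemxAr mxE MN.
by rewrite (negbTE jk) mulr0.
Qed.

(** * Binary encoding and injectivity of [theta] *)

Lemma sum_binary_lt (k : nat) (b : 'I_k -> bool) :
  (\sum_(j < k) b j * 2 ^ j < 2 ^ k)%N.
Proof.
elim: k b => [|k IHk] b; first by rewrite big_ord0.
have := IHk (fun j => b (widen_ord (leqnSn k) j)).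
rewrite big_ord_recr expnS /=; move: (\sum_(i < k) _)%N (2 ^ k)%N => S p.
by case: (b ord_max); lia.
Qed.

Lemma sum_binary_inj (k : nat) (b c : 'I_k -> bool) :
  (\sum_(j < k) b j * 2 ^ j = \sum_(j < k) c j * 2 ^ j)%N -> b =1 c.
Proof.
elim: k b c => [|k IHk] b c; first by move=> _ [].
rewrite !big_ord_recr /=.
have := sum_binary_lt (fun j => b (widen_ord (leqnSn k) j)).
have := sum_binary_lt (fun j => c (widen_ord (leqnSn k) j)).
move=> cl bl e.
(* The low digits add up to less than 2 ^ k on both sides, so the top digits must agree. *)
have [/IHk low bc] : (\sum_(j < k) b (widen_ord (leqnSn k) j) * 2 ^ j =
    \sum_(j < k) c (widen_ord (leqnSn k) j) * 2 ^ j)%N /\ b ord_max = c ord_max.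
  move: cl bl e; move: (\sum_(j < k) _)%N (\sum_(j < k) _)%N (2 ^ k)%N => S S' p.
  by case: (b _); case: (c _); split; lia.
move=> j; have [jk|kj] := ltnP j k.
  have -> : j = widen_ord (leqnSn k) (Ordinal jk) by apply: val_inj.
  exact: low.
have -> // : j = ord_max.
by apply/val_inj/eqP; rewrite eqn_leq kj -ltnS ltn_ord.
Qed.

Section Theta.
Variables (F : fieldType) (m n : nat) (A : 'M[F]_(m, n)).

Lemma theta2_lt s : (theta2 A s < 2 ^ m)%N.
Proof. exact: sum_binary_lt. Qed.

Lemma theta_mod s : (theta A s %% 2 ^ m)%N = theta2 A s.
Proof. by rewrite /theta /theta1 expnD mulnC modnMDl modn_small ?theta2_lt. Qed.

(** This uniform bound yields the existence of maximisers, in place of a finiteness argument for the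
    set of normalised normal vectors. *)
Lemma theta_le s : (theta A s <= 2 ^ (m + m) + 2 ^ m)%N.
Proof.
apply: leq_add; last exact: ltnW (theta2_lt s).
rewrite leq_exp2l // leq_add2l -[leqRHS]card_ord -sum1_card.
by apply: leq_sum => j _; apply: leq_b1.
Qed.

Lemma theta_inj s s' :
  normalised_normals A s -> normalised_normals A s' ->
  theta A s = theta A s' -> s = s'.
Proof.
move=> /normalised_normalsE[ns mins] /normalised_normalsE[ns' _] e.
have Z : forall j, ((A *m s) j 0 == 0) = ((A *m s') j 0 == 0).
  by apply: sum_binary_inj; rewrite -[LHS](theta_mod s) e theta_mod.
have [j /eqP|c s'E] := mins s'; first by rewrite Z => /eqP.
by move: ns'; rewrite s'E => /(normalised_scale_inj ns) ->; rewrite scale1r.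
Qed.

End Theta.

Lemma argmax_nonempty (T : Type) (f : T -> nat) (X : set T) (N : nat) :
  X !=set0 -> (forall x, f x <= N)%N -> argmax f X !=set0.
Proof.
move=> [x Xx] fN; pose P k := `[< exists2 x, X x & f x = k >].
have exP : exists k, P k by exists (f x); apply/asboolP; exists x.
have ubP k : P k -> (k <= N)%N by move=> /asboolP[y _ <-].
case: (ex_maxnP exP ubP) => k /asboolP[y Xy <-] maxk.
by exists y; split=> // z Xz; apply: maxk; apply/asboolP; exists z.
Qed.

(** * Existence and uniqueness of the recursion *)

Section Recursion.
Variables (F : fieldType) (m n : nat) (A : 'M[F]_(m, n)).

Lemma candidates_nonempty t :
  \rank A = n -> (size t < n)%N -> candidates A t !=set0.
Proof.
move=> rA tn; have [|s sA st] := exists_normal_notin (U := <<t>>) rA.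
  exact: leq_ltn_trans (dim_span t) tn.
by exists s.
Qed.

Lemma argmax_candidates_nonempty t :
  candidates A t !=set0 -> argmax (theta A) (candidates A t) !=set0.
Proof. by move=> /argmax_nonempty; apply; apply: theta_le. Qed.

Lemma argmax_candidates_unique t s s' :
  argmax (theta A) (candidates A t) s -> argmax (theta A) (candidates A t) s' ->
  s = s'.
Proof.
move=> [st maxs] [s't maxs']; apply: theta_inj (st.1) (s't.1) _.
by apply/eqP; rewrite eqn_leq maxs // maxs'.
Qed.

(** Appending a vector leaves the earlier prefixes unchanged; this makes induction from the end of
    the list available. *)
Lemma recursion_rcons t s :
  recursion A (rcons t s) <->
  recursion A t /\ argmax (theta A) (candidates A t) s.
Proof.
split=> [rec|[rec maxs] j].
  split=> [j jt|].
    have := rec j; rewrite size_rcons ltnS nth_rcons jt -cats1.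
    by rewrite takel_cat (ltnW jt) //; apply.
  have := rec (size t); rewrite size_rcons ltnS leqnn => /(_ isT).
  by rewrite nth_rcons ltnn eqxx -cats1 take_size_cat.
rewrite size_rcons ltnS leq_eqVlt nth_rcons -cats1 => /predU1P[->|jt].
  by rewrite ltnn eqxx take_size_cat.
by rewrite jt takel_cat ?(ltnW jt) //; apply: rec.
Qed.

Lemma recursion_free t : recursion A t -> free t.
Proof.
elim/last_ind: t => [|t s IHt]; first by rewrite nil_free.
move=> /recursion_rcons[/IHt ft [[_ st] _]].
by rewrite (perm_free (permEl (perm_rcons s t))) free_cons st.
Qed.

Lemma recursion_unique t t' :
  recursion A t -> recursion A t' -> size t = size t' -> t = t'.
Proof.
elim/last_ind: t t' => [|t s IHt] t'; first by move=> _ _ /esym/size0nil ->.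
case/lastP: t' => [|t' s']; first by rewrite size_rcons.
move=> /recursion_rcons[rt ms] /recursion_rcons[rt' ms']; rewrite !size_rcons.
move=> [/(IHt _ rt rt') tt']; rewrite -tt' in ms' *.
by rewrite (argmax_candidates_unique ms ms').
Qed.

Lemma recursion_exists k :
  \rank A = n -> (k <= n)%N -> exists2 t, size t = k & recursion A t.
Proof.
move=> rA; elim: k => [|k IHk] kn; first by exists [::].
have [t tk rt] := IHk (ltnW kn).
have [|s ms] := argmax_candidates_nonempty (t := t).
  by apply: candidates_nonempty; rewrite ?tk.
by exists (rcons t s); rewrite ?size_rcons ?tk //; apply/recursion_rcons.
Qed.

Lemma normal_form_exists : \rank A = n -> exists B, normal_form A B.
Proof.
move=> rA; have [t /eqP tn rt] := recursion_exists rA (leqnn n).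
exists (\matrix_(i, j) (A *m tnth (Tuple tn) j) i 0); exists (Tuple tn) => // j.
by apply/colP => i; rewrite !mxE.
Qed.

Lemma normal_form_unique B B' : normal_form A B -> normal_form A B' -> B = B'.
Proof.
move=> [t rt tB] [t' rt' t'B].
have tt' : t = t'.
  by apply: val_inj; apply: recursion_unique; rewrite ?size_tuple.
apply/matrixP => i j; have := t'B j; rewrite -tt' -tB => /colP/(_ i).
by rewrite !mxE => ->.
Qed.

End Recursion.

(** * Invariance under a change of basis *)

Section ChangeOfBasis.
Variables (F : fieldType) (m n : nat) (A : 'M[F]_(m, n)) (P : 'M[F]_n).
Hypothesis uP : P \in unitmx.

Local Notation "s '^P'" := (invmx P *m s) (at level 8, format "s '^P'").

Lemma mulmx_invK (s : 'cV[F]_n) : (A *m P) *m s^P = A *m s.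
Proof. by rewrite -mulmxA mulKVmx. Qed.

Lemma normalised_normals_mulmx s :
  normalised_normals (A *m P) s^P <-> normalised_normals A s.
Proof.
have normE : normalised (A *m P) s^P = normalised A s.
  by rewrite /normalised mulmx_invK.
split=> /normalised_normalsE; rewrite ?normE => -[ns mins];
  apply/normalised_normalsE; rewrite ?normE; split=> // s' Z.
  have [i|c s'E] := mins s'^P; first by rewrite !mulmx_invK => /Z.
  by exists c; rewrite -[LHS](mulKVmx uP) s'E -scalemxAr mulKVmx.
have [i|c s'E] := mins (P *m s').
  by move=> Asi; rewrite mulmxA; apply: Z; rewrite mulmx_invK.
by exists c; rewrite -[LHS](mulKmx uP) s'E -scalemxAr.
Qed.

Lemma theta_mulmx s : theta (A *m P) s^P = theta A s.
Proof. by rewrite /theta /theta1 /theta2 /theta_ind mulmx_invK. Qed.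

Lemma candidates_mulmx t s :
  candidates (A *m P) [seq u^P | u <- t] s^P <-> candidates A t s.
Proof.
(* Each direction takes the image of the span under multiplication by P or by its inverse. *)
have spanE : (s^P \in <<[seq u^P | u <- t]>>%VS) = (s \in <<t>>%VS).
  apply/idP/idP => /(memv_img _).
    move=> /(_ _ (linfun (mulmx P))); rewrite limg_span lfunE /= mulKVmx //.
    rewrite -map_comp (eq_map (_ : _ =1 id)) ?map_id // => u /=.
    by rewrite lfunE /= mulKVmx.
  move=> /(_ _ (linfun (mulmx (invmx P)))); rewrite limg_span lfunE /=.
  by rewrite (eq_map (_ : _ =1 (mulmx (invmx P)))) // => u; rewrite lfunE.
by rewrite /candidates /= spanE; split=> -[/normalised_normals_mulmx].
Qed.

Lemma argmax_mulmx t s :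
  argmax (theta A) (candidates A t) s ->
  argmax (theta (A *m P)) (candidates (A *m P) [seq u^P | u <- t]) s^P.
Proof.
move=> [st maxs]; split=> [|u]; first exact/candidates_mulmx.
(* Any competitor [u] is P^-1 (P u), so it comes from the candidate P u for [A]. *)
by rewrite -[u](mulKmx uP) !theta_mulmx => /candidates_mulmx /maxs.
Qed.

Lemma normal_form_mulmx B : normal_form A B -> normal_form (A *m P) B.
Proof.
move=> [t rt tB]; exists (map_tuple (mulmx (invmx P)) t) => [j|j].
  rewrite size_map => jt; rewrite -map_take (nth_map 0) //.
  exact/argmax_mulmx/rt.
by rewrite tnth_map mulmx_invK.
Qed.

End ChangeOfBasis.

(** * Matrices as bases of a subspace *)

Lemma free_columns (F : fieldType) (m n : nat) (A : 'M[F]_(m, n)) :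
  free (columns A) = (\rank A == n).
Proof.
rewrite (@free_row_free F _ n m trmx (columns A) (@trmx_inj _ _ _)).
rewrite -[in RHS]mxrank_tr; congr (\rank _ == n).
by apply/row_matrixP => j; rewrite rowK -tr_col -tnth_nth tnth_mktuple.
Qed.

Lemma col_in_columns (F : fieldType) (m n : nat) (A : 'M[F]_(m, n)) j :
  col j A \in columns A.
Proof.
have <- : tnth (columns A) j = col j A by rewrite tnth_mktuple.
exact: mem_tnth.
Qed.

Lemma mulmx_in_span_columns (F : fieldType) (m n : nat) (A : 'M[F]_(m, n)) s :
  A *m s \in <<columns A>>%VS.
Proof.
rewrite -[A *m s]trmxK trmx_mul mulmx_sum_row linear_sum memv_suml // => j _.
rewrite linearZ memvZ //= -tr_col trmxK memv_span //.
exact: col_in_columns.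
Qed.

Lemma basis_columns_change (F : fieldType) (m n : nat) (V : {vspace 'cV[F]_m})
    (A A' : 'M[F]_(m, n)) :
  basis_of V (columns A) -> basis_of V (columns A') ->
  exists2 P, P \in unitmx & A' = A *m P.
Proof.
move=> bA bA'.
pose P := \matrix_(i, j) coord (columns A) i (col j A').
have A'E : A' = A *m P.
  apply/matrixP => i j.
  have jV : col j A' \in V.
    by apply: (basis_mem bA'); apply: col_in_columns.
  have /colP/(_ i) := coord_basis bA jV; rewrite mxE summxE => ->.
  rewrite mxE; apply: eq_bigr => k _.
  by rewrite !mxE -tnth_nth tnth_mktuple mxE mulrC.
(* Invertibility by rank: n = rank A' = rank (A P) <= rank P. *)
exists P => //; rewrite -row_full_unit /row_full eqn_leq rank_leq_row /=.
have := basis_free bA'; rewrite free_columns => /eqP {1}<-.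
by rewrite A'E mxrankM_maxr.
Qed.

Lemma normal_form_basis (F : fieldType) (m n : nat) (V : {vspace 'cV[F]_m})
    (A B : 'M[F]_(m, n)) :
  basis_of V (columns A) -> normal_form A B -> basis_of V (columns B).
Proof.
move=> bA [t /recursion_free ft tB].
have rA : row_free A^T.
  by rewrite /row_free mxrank_tr -free_columns (basis_free bA).
rewrite basisEfree size_tuple (size_basis bA) leqnn andbT; apply/andP; split.
  (* The chosen vectors are independent, so [T] has rank n, and multiplying by the row-free A^T
     preserves this rank. *)
  pose T := \matrix_(j < n) (t`_j)^T.
  have -> : B = (T *m A^T)^T.
    rewrite trmx_mul trmxK; apply/matrixP => i j.
    have /colP/(_ i) := tB j; rewrite !mxE => ->; apply: eq_bigr => k _.
    by rewrite !mxE -tnth_nth.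
  rewrite free_columns mxrank_tr mxrankMfree //.
  by rewrite (@free_row_free F _ n n trmx t (@trmx_inj _ _ _)) in ft.
apply/span_subvP => u /tnthP[j ->]; rewrite tnth_mktuple tB.
by rewrite -(span_basis bA) mulmx_in_span_columns.
Qed.

Lemma normal_form_basis_unique (F : fieldType) (m n : nat)
    (V : {vspace 'cV[F]_m}) (A A' B B' : 'M[F]_(m, n)) :
  basis_of V (columns A) -> basis_of V (columns A') ->
  normal_form A B -> normal_form A' B' -> B = B'.
Proof.
move=> bA bA' AB A'B'; have [P uP A'E] := basis_columns_change bA bA'.
apply: normal_form_unique A'B'; rewrite A'E.
exact: normal_form_mulmx.
Qed.

(** * The square case: the identity matrix *)

Lemma normalised_normals1 (F : fieldType) (n : nat) (s : 'cV[F]_n) :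
  normalised_normals 1%:M s <-> exists i, s = delta_mx i 0.
Proof.
have norm i : normalised 1%:M (delta_mx i 0 : 'cV[F]_n).
  exists i; rewrite mul1mx mxE !eqxx; split=> // k ki.
  by rewrite mxE (negbTE (_ : k != i)) // -val_eqE neq_ltn ki.
split=> [/normalised_normalsE[ns mins]|[i ->]].
  have [i0 [si0 _]] := ns; rewrite mul1mx in si0.
  (* As [s] is non-zero at [i0], this unit vector has its support inside that of [s]. *)
  have [i|c sE] := mins (delta_mx i0 0).
    rewrite !mul1mx mxE andbT => si; rewrite (negbTE (_ : i != i0)) //.
    by apply/eqP => ii0; move: si; rewrite ii0 si0 => /eqP; rewrite oner_eq0.
  have := norm i0; rewrite sE => /(normalised_scale_inj ns) c1.
  by exists i0; rewrite sE c1 scale1r.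
apply/normalised_normalsE; split=> // s'; rewrite !mul1mx => Z.
exists (s' i 0); apply/colP => k; rewrite !mxE andbT.
have [->|ki] := eqVneq k i; first by rewrite mulr1.
by rewrite mulr0 Z // mxE (negbTE ki).
Qed.

(** All entries but the i-th vanish, so only the digit 2 ^ i is missing from the full binary sum; it
    stands on the left to avoid truncated subtraction. *)
Lemma theta_delta (F : fieldType) (n : nat) (i : 'I_n) :
  (theta 1%:M (delta_mx i 0%R : 'cV[F]_n) + 2 ^ i =
   2 ^ (n + n.-1) + \sum_(j < n) 2 ^ j)%N.
Proof.
have indE j : theta_ind 1%:M (delta_mx i 0 : 'cV[F]_n) j = (j != i).
  rewrite /theta_ind mul1mx mxE andbT; case: (j == i); last by rewrite eqxx.
  by rewrite oner_eq0.
rewrite -addnA; congr (2 ^ (n + _) + _)%N.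
  have -> : n.-1 = #|predC1 i| by rewrite cardC1 card_ord.
  rewrite -sum1_card [RHS]big_mkcond; apply: eq_bigr => j _.
  by rewrite indE inE; case: (j == i).
rewrite /theta2 (bigD1 i) //= [RHS](bigD1 i) //= indE eqxx mul0n add0n addnC.
by congr addn; apply: eq_bigr => j ji; rewrite indE ji mul1n.
Qed.

Lemma normal_form1 (F : fieldType) (n : nat) :
  normal_form (1%:M : 'M[F]_n) 1%:M.
Proof.
exists [tuple delta_mx i 0 | i < n] => [j|j]; last first.
  by rewrite colE !mul1mx tnth_mktuple.
rewrite size_tuple => jn; set t := (X in take j X).
have tE (i : 'I_n) : t`_i = delta_mx i 0 by rewrite -tnth_nth tnth_mktuple.
have memt (i : 'I_n) : (i < j)%N -> delta_mx i 0 \in take j t.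
  move=> ij; rewrite -tE -(nth_take 0 ij); apply: mem_nth.
  by rewrite size_takel // size_tuple ltnW.
pose j' := Ordinal jn; rewrite -[j in t`_j]/(val j') tE.
split=> [|u [/normalised_normals1[i ->] it]]; last first.
  (* Unit vectors of smaller index are already chosen, and among the others [theta] is largest at
     index j by [theta_delta]. *)
  have ji : (j <= i)%N by rewrite leqNgt; apply: contra it => /memt/memv_span.
  have := theta_delta F i; rewrite -(theta_delta F j').
  have : (2 ^ j <= 2 ^ i)%N by rewrite leq_exp2l.
  by move: (theta _ _) (theta _ _) (2 ^ i)%N => /=; lia.
split; first by apply/normalised_normals1; exists j'.
(* The j-th coordinate vanishes on all vectors chosen before but not on the j-th unit vector. *)
apply/negP; have sub : (<<take j t>> <= lker (linfun (@row F n 1 j')))%VS.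
  apply/span_subvP => u /(nthP 0)[k].
  rewrite size_takel ?size_tuple ?(ltnW jn) // => kj <-.
  rewrite memv_ker lfunE /= nth_take //; pose k' := Ordinal (ltn_trans kj jn).
  rewrite -[k]/(val k') tE; apply/eqP/rowP => l; rewrite !mxE -val_eqE /=.
  by rewrite gtn_eqF.
move=> /(subvP sub); rewrite memv_ker lfunE /= => /eqP/rowP/(_ 0).
by rewrite !mxE !eqxx => /eqP; rewrite oner_eq0.
Qed.

Unset Implicit Arguments.

Theorem theorem1 (R : realType) (F : fieldType)
    (hF : F = (R : fieldType) \/ F = (R[i] : fieldType)) :
  (forall (m n : nat) (A : 'M[F]_(m, n)),
     (2 <= n)%N -> (n <= m)%N -> \rank A = n ->
     [/\ normalised_normals A !=set0,
         forall t : seq 'cV[F]_n, (size t < n)%N -> recursion A t ->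
           candidates A t !=set0 /\
           exists! s, argmax (theta A) (candidates A t) s
       & exists! B : 'M[F]_(m, n), normal_form A B]) /\
  (forall (m n : nat) (V : {vspace 'cV[F]_m}),
     (2 <= n)%N -> \dim V = n ->
     (exists! B : 'M[F]_(m, n),
        basis_of V (columns B) /\
        exists2 A : 'M[F]_(m, n), basis_of V (columns A) & normal_form A B) /\
     (forall A A' B B' : 'M[F]_(m, n),
        basis_of V (columns A) -> basis_of V (columns A') ->
        normal_form A B -> normal_form A' B' -> B = B')) /\
  (forall (m : nat) (A : 'M[F]_m),
     (2 <= m)%N -> \rank A = m -> normal_form A 1%:M).
Proof.
split; [|split].
- move=> m n A n2 _ rA; split.
  + have [s [sA _]] := candidates_nonempty (t := [::]) rA (ltnW n2).
    by exists s.
  + move=> t tn rt; have ct := candidates_nonempty rA tn; split=> //.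
    have [s ms] := argmax_candidates_nonempty ct.
    by exists s; split=> // s'; apply: argmax_candidates_unique.
  + have [B AB] := normal_form_exists rA.
    by exists B; split=> // B'; apply: normal_form_unique.
- move=> m n V n2 dV.
  split; last exact: normal_form_basis_unique.
  pose A : 'M[F]_(m, n) := \matrix_(i, j) (vbasis V)`_j i 0.
  have bA : basis_of V (columns A).
    rewrite (_ : columns A = vbasis V :> seq _) ?vbasisP //.
    apply: (@eq_from_nth _ 0) => [|j]; rewrite !size_tuple // => jn.
    rewrite -[j]/(val (Ordinal jn)) -tnth_nth tnth_mktuple.
    by apply/colP => i; rewrite !mxE.
  have rA : \rank A = n by apply/eqP; rewrite -free_columns (basis_free bA).
  have [B AB] := normal_form_exists rA.
  exists B; split; first by split; [exact: normal_form_basis AB | exists A].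
  by move=> B' [_ [A' bA' A'B']]; exact: normal_form_basis_unique bA bA' AB A'B'.
(* The invertible [A] itself is the change of basis from the identity matrix. *)
- move=> m A _ rA; rewrite -[A]mul1mx; apply: normal_form_mulmx.
    by rewrite -row_full_unit; apply/eqP.
  exact: normal_form1.
Qed.
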